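(* If $A$ is a finite set then an $A$-selector is minimal if and only if it is totally ordered, and thus it is an $A$-enumerator if and only if it is totally ordered.
   Context: A set $E$ is defined to be finite if $\mathcal{P}(E)$ is the only subset $\mathcal{S}$ of the power set $\mathcal{P}(E)$ such that $\varnothing \in \mathcal{S}$ and $F \cup \{e\} \in \mathcal{S}$ whenever $F \in \mathcal{S}$, $F \neq E$ and $e \in E \setminus F$ (this is equivalent to the usual notion of finiteness). For $\mathcal{U} \subset \mathcal{P}(E)$ let $\mathcal{U}^p$ be the set of those elements of $\mathcal{U}$ which are proper subsets of $E$. A subset $\mathcal{U}$ of $\mathcal{P}(E)$ is an $E$-selector if $\varnothing \in \mathcal{U}$ and for each $U \in \mathcal{U}^p$ there exists a unique element $e \in E \setminus U$ such that $U \cup \{e\} \in \mathcal{U}$. If $\mathcal{U}$ is an $E$-selector then a subset $\mathcal{V}$ of $\mathcal{U}$ is invariant if $\varnothing \in \mathcal{V}$ and $V \cup \{e\} \in \mathcal{V}$ for all $V \in \mathcal{V}^p$, where $e$ is the unique element of $E \setminus V$ with $V \cup \{e\} \in \mathcal{U}$. An $E$-selector $\mathcal{U}$ is minimal if the only invariant subset of $\mathcal{U}$ is $\mathcal{U}$ itself. An $E$-enumerator is a minimal $E$-selector which contains $E$ as an element. A subset $\mathcal{U}$ of $\mathcal{P}(E)$ is totally ordered if for all $E_1, E_2 \in \mathcal{U}$ either $E_1 \subset E_2$ or $E_2 \subset E_1$. *)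

(* Defs.v *)
From mathcomp Require Import all_boot.
From mathcomp Require Import boolp classical_sets.

Set Implicit Arguments.
Unset Strict Implicit.
Unset Printing Implicit Defensive.

Local Open Scope classical_set_scope.

(* The ground set E is an arbitrary subset of an arbitrary type T. *)

Definition power {T : Type} (E : set T) : set_system T := [set F | F `<=` E].

(* Finiteness is this induction principle on P(E), not
   [cardinality.finite_set], to which it is equivalent. *)
Definition inductively_finite {T : Type} (E : set T) : Prop :=
  forall S : set_system T,
    S `<=` power E ->
    S set0 ->
    (forall F e, S F -> F <> E -> (E `\` F) e -> S (F `|` [set e])) ->
    S = power E.

Definition proper_members {T : Type} (E : set T) (U : set_system T) :
  set_system T := [set F | U F /\ F `<` E].

Definition selector {T : Type} (E : set T) (U : set_system T) : Prop :=
  [/\ U `<=` power E,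
      U set0 &
      forall F, proper_members E U F ->
        exists! e, (E `\` F) e /\ U (F `|` [set e])].

(* For a selector U, the e quantified in the last clause exists and is
   unique for each F. *)
Definition invariant {T : Type} (E : set T) (U V : set_system T) : Prop :=
  [/\ V `<=` U,
      V set0 &
      forall F e, proper_members E V F ->
        (E `\` F) e -> U (F `|` [set e]) -> V (F `|` [set e])].

Definition minimal_selector {T : Type} (E : set T) (U : set_system T) : Prop :=
  selector E U /\ forall V, invariant E U V -> V = U.

Definition enumerator {T : Type} (E : set T) (U : set_system T) : Prop :=
  minimal_selector E U /\ U E.

Definition totally_ordered {T : Type} (U : set_system T) : Prop :=
  total_on U subset.

(* Main.v *)
Require Import Defs.
From mathcomp Require Import all_boot.
From mathcomp Require Import boolp classical_sets.

(** A selector [U] comes with a successor operation sending a proper member [F]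
    to the unique member of the form [F `|` [set e]] with [e] outside [F], and
    minimality of [U] is the principle of induction along this successor.

    A minimal selector is totally ordered for the same reason that Zermelo's
    chains are: nothing fits strictly between [F] and [F `|` [set e]].  Hence if
    [F] is comparable with all members, induction shows that each member is
    either below [F] or above the successor of [F]
    ([minimal_selector_successor_gap]), so the successor of [F] is comparable
    with all members too, and a second induction concludes.

    Conversely, let [U] be totally ordered, [V] an invariant subset and [G] a
    member of [U].  If a member [F] of [V] lies strictly below [G], then by
    comparability its successor still lies below [G].  So the members of [V]
    below [G] form a family in which one can always climb towards [G]; in a
    finite set a family has a maximal member ([exists_maximal_member]), which can
    then only be [G] itself ([climb_to_top]).  Thus [G] is in [V].  Climbing
    inside [U] towards [A] likewise shows that every selector on a finite set [A]
    contains [A], so that minimal selectors on [A] and enumerators coincide. *)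

Local Open Scope classical_set_scope.

Lemma subset_neq_proper {T : Type} {F G : set T} :
  F `<=` G -> F <> G -> F `<` G.
Proof. by move=> FG neq; split=> // GF; apply: neq; apply/seteqP. Qed.

Lemma covering_step {T : Type} {F H : set T} {e : T} :
  F `<=` H -> H `<=` F `|` [set e] -> H <> F -> H = F `|` [set e].
Proof.
move=> FH HFe neq; apply/seteqP; split=> // x [/FH//|->].
apply: contrapT => nHe; apply: neq; apply/seteqP; split=> // y Hy.
by case: (HFe y Hy) => // ye; case: nHe; rewrite -ye.
Qed.

(** The induction runs on a bound [X] for the complement of some member [F0] of
    the family.  When [X] gains a point [e], either a member above [F0] contains
    [e], and it leaves at most [X] uncovered; or none does, and then adjoining
    [e] to all the members above [F0] does not change the order between them but
    brings the complement of the least one back inside [X]. *)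
Lemma exists_maximal_member {T : Type} {A : set T} {S : set_system T}
    {F0 : set T} :
  inductively_finite A -> S `<=` power A -> S F0 ->
  exists2 M, S M & forall F, S F -> M `<=` F -> F = M.
Proof.
move=> finA.
pose P X := forall (S : set_system T) F0, S `<=` power A -> S F0 ->
  A `\` F0 `<=` X -> exists2 M, S M & forall F, S F -> M `<=` F -> F = M.
suff PA : [set X | X `<=` A /\ P X] = power A.
  have [_ PAA] : [set X | X `<=` A /\ P X] A by rewrite PA.
  by move=> SA SF0; apply: PAA SF0 _ => // x [].
apply: finA => [X []//||X e [XA PX] _ [Ae nXe]].
- split=> // {}S {}F0 SA SF0 cov; exists F0 => // F SF F0F.
  apply/seteqP; split=> // x Fx; apply: contrapT => nF0x.
  by apply: (cov x); split=> //; apply: SA Fx.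
split=> [x [/XA//|->//]|{}S {}F0 SA SF0 cov].
have [[G [SG F0G Ge]]|noe] := pselect (exists G, [/\ S G, F0 `<=` G & G e]).
- apply: (PX S G) => // x [Ax nGx].
  case: (cov x) => [|//|xe]; first by split=> // /F0G.
  by case: nGx; rewrite xe.
pose above := [set G | S G /\ F0 `<=` G].
have nabove G : above G -> ~ G e by move=> [SG F0G] Ge; apply: noe; exists G.
have [||x [Ax nx]|_ [G [SG F0G] <-] maxG] :=
  PX [set G `|` [set e] | G in above] (F0 `|` [set e]).
- by move=> _ [G [/SA GA _] <-] x [/GA//|->].
- by exists F0 => //; split.
- case: (cov x) => [|//|xe]; first by split=> // F0x; apply: nx; left.
  by case: nx; right.
exists G => // F SF GF.
have aF : above F by split=> //; apply: subset_trans GF.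
have FeGe : F `|` [set e] = G `|` [set e].
  by apply: maxG; [exists F|apply: setSU].
apply/seteqP; split=> // x Fx.
have : (F `|` [set e]) x by left.
by rewrite FeGe => -[//|xe]; case: (nabove F aF); rewrite -xe.
Qed.

Lemma climb_to_top {T : Type} {A G : set T} {S : set_system T} :
  inductively_finite A -> G `<=` A -> S `<=` power G -> S set0 ->
  (forall F, S F -> F `<` G -> exists2 e, ~ F e & S (F `|` [set e])) ->
  S G.
Proof.
move=> finA GA SG S0 step.
have [|M SM maxM] := exists_maximal_member finA _ S0.
  by move=> F /SG FG; apply: subset_trans GA.
have [<-//|neq] := pselect (M = G).
have [e nMe SMe] := step M SM (subset_neq_proper (SG _ SM) neq).
by case: nMe; rewrite -(maxM _ SMe (@subsetUl _ M [set e])); right.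
Qed.

Lemma selector_top {T : Type} {A : set T} {U : set_system T} :
  inductively_finite A -> selector A U -> U A.
Proof.
move=> finA [UA U0 succU]; apply: (climb_to_top finA) => // F UF FA.
by have [e [[[_ nFe] UFe] _]] := succU F (conj UF FA); exists e.
Qed.

(** If the successor of a member [H] below [F] were not below [F], it would be
    above [F] because [F] is comparable with everything; the covering property
    then leaves only [H] and its successor as possible values of [F]. *)
Lemma minimal_selector_successor_gap {T : Type} {A F : set T}
    {U : set_system T} {e : T} :
  minimal_selector A U -> U F -> (A `\` F) e -> U (F `|` [set e]) ->
  (forall G, U G -> F `<=` G \/ G `<=` F) ->
  forall G, U G -> G `<=` F \/ F `|` [set e] `<=` G.
Proof.
move=> [[UA U0 succU] minU] UF AFe UFe cmpF.
suff W : [set G | U G /\ (G `<=` F \/ F `|` [set e] `<=` G)] = U.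
  by move=> G; rewrite -{1}W => -[].
apply: minU; split=> [G []//||H d [[UH cmpH] HA] AHd UHd].
  by split=> //; left.
split=> //; case: cmpH => [HF|FeH]; last first.
  by right; apply: subset_trans FeH _; apply: subsetUl.
have [FH|neq] := pselect (F = H).
  right; subst H; have [c [_ uniq]] := succU F (conj UF HA).
  by rewrite -(uniq e) // -(uniq d).
case: (cmpF _ UHd) => [FHd|]; last by left.
by left; rewrite -(covering_step HF FHd neq).
Qed.

Lemma minimal_selector_totally_ordered {T : Type} {A : set T}
    {U : set_system T} : minimal_selector A U -> totally_ordered U.
Proof.
move=> minU; have [[UA U0 _] indU] := minU.
suff W : [set F | U F /\ forall G, U G -> F `<=` G \/ G `<=` F] = U.
  by move=> F G; rewrite -{1}W => -[_ cmpF] /cmpF.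
apply: indU; split=> [F []//||F e [[UF cmpF] _] AFe UFe].
  by split=> // G _; left.
split=> // G UG.
have [GF|] := minimal_selector_successor_gap minU UF AFe UFe cmpF G UG.
  by right; apply: subset_trans GF _; apply: subsetUl.
by left.
Qed.

Lemma totally_ordered_minimal_selector {T : Type} {A : set T}
    {U : set_system T} :
  inductively_finite A -> selector A U -> totally_ordered U ->
  minimal_selector A U.
Proof.
move=> finA selU totU; split=> // V [VU V0 succV].
have [UA _ succU] := selU.
apply/seteqP; split=> // G UG.
suff [] : [set F | V F /\ F `<=` G] G by [].
apply: (climb_to_top finA) => [|F []//||F [VF _] FG]; first exact: UA.
  by split.
have FA : F `<` A.
  case: FG => FG nGF; split=> [|AF]; first exact: UA (VU _ VF).
  by apply: nGF => x /(UA _ UG)/AF.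
have [e [[AFe UFe] _]] := succU F (conj (VU _ VF) FA).
exists e; first by case: AFe.
split; first exact: succV.
have [//|GFe] := totU _ _ UFe UG.
case: FG => FG nGF; rewrite -(covering_step FG GFe) // => GF.
by apply: nGF; rewrite GF.
Qed.

Theorem theorem6p2 (T : Type) (A : set T) (hA : inductively_finite A)
    (U : set_system T) (hU : selector A U) :
  (minimal_selector A U <-> totally_ordered U) /\
  (enumerator A U <-> totally_ordered U).
Proof.
have minE : minimal_selector A U <-> totally_ordered U.
  split; first exact: minimal_selector_totally_ordered.
  exact: totally_ordered_minimal_selector.
split=> //; split=> [[/minE]//|/minE minU].
by split=> //; apply: selector_top.
Qed.
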